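(* Let $\mathbf{G}=(G_1,G_2,G_3)$ be a $3$-colouring template on $n$ vertices, and let $r\in\mathbb{N}$ (so $r\geq 1$). If $\mathbf{G}$ contains no rainbow triangle and satisfies $\delta(G_1)>\left(1-\frac{1}{r}\right)n$ and $\delta(G_2)\geq \delta(G_3)>0$, then $\delta(G_2)+\delta(G_3)\leq \frac{2n}{r+1}$. In particular, $\delta(G_3)\leq \frac{n}{r+1}$.
   Context: All graphs are finite and simple. A $3$-colouring template on a vertex set $V$ is a triple $\mathbf{G}=(G_1,G_2,G_3)$ of graphs, each with vertex set $V$; the edge sets of $G_1,G_2,G_3$ are allowed to overlap. It is a template on $n$ vertices if $|V|=n$. A rainbow triangle in $\mathbf{G}$ is a triple of edges $(e_1,e_2,e_3)$ with $e_i\in E(G_i)$ for each $i\in\{1,2,3\}$ such that $\{e_1,e_2,e_3\}$ is the set of three edges of a triangle on three distinct vertices of $V$. For a graph $G$, $\delta(G)$ denotes its minimum degree. $\mathbb{N}$ denotes the set of positive integers. *)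

(* Defs.v *)
From HB Require Import structures.
From mathcomp Require Import all_boot all_order all_algebra.

Set Implicit Arguments.
Unset Strict Implicit.
Unset Printing Implicit Defensive.

Record sgraph (V : finType) := SGraph {
  adj :> rel V;
  adj_sym : symmetric adj;
  adj_irrefl : irreflexive adj
}.

Definition edges (V : finType) (G : sgraph V) : {set {set V}} :=
  [set [set x; y] | x in V, y in V & G x y].

Definition degree (V : finType) (G : sgraph V) (x : V) : nat :=
  #|[set y | G x y]|.

(* The default value #|V| exceeds every degree, so it does not affect the
   minimum when V is nonempty; for empty V the value is 0. *)
Definition min_degree (V : finType) (G : sgraph V) : nat :=
  \big[minn/#|V|]_(x : V) degree G x.

Record template (V : finType) := Template {
  G1 : sgraph V;
  G2 : sgraph V;
  G3 : sgraph V
}.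

Definition triangle_edges (V : finType) (x y z : V) : {set {set V}} :=
  [set [set x; y]; [set y; z]; [set z; x]].

Definition rainbow_triangle (V : finType) (G : template V)
    (e1 e2 e3 : {set V}) : Prop :=
  [/\ e1 \in edges (G1 G), e2 \in edges (G2 G), e3 \in edges (G3 G) &
      exists x y z : V,
        [/\ x != y, y != z, z != x & [set e1; e2; e3] = triangle_edges x y z]].

(* Main.v *)
Require Import Defs.
From HB Require Import structures.
From mathcomp Require Import all_boot all_order all_algebra.
From mathcomp Require Import zify ring lra.

Set Implicit Arguments.
Unset Strict Implicit.
Unset Printing Implicit Defensive.

Import Order.TTheory GRing.Theory Num.Theory.

(** Write [n] for the number of vertices, [d1, d2, d3] for the minimum degrees
    of the three graphs [H1, H2, H3], and [a = n - d1].  A vertex [x] has at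
    most [a] vertices outside its [H1]-neighbourhood ([far H1 x], which contains
    [x]), and the hypothesis on [d1] says exactly that [r * a < n].  The claim
    is [(r + 1) * (d2 + d3) <= 2 * n]; assume it fails, which forces
    [a < d2 + d3].

    Call [x] and [y] linked when some [w] satisfies [H2 x w] and [H3 y w].
    There is no rainbow triangle, so linked vertices are not [H1]-adjacent and
    the set [link x] of vertices linked to [x] has at most [a] elements.  The
    main point is that linking is symmetric, robustly so: if [w] witnesses that
    [x] and [y] are linked, then the [H3]-neighbours of [x] and the
    [H2]-neighbours of [y] all lie in [far H1 w], and as [a < d2 + d3] these
    two sets overlap, in at least [d2 + d3 - a] points ([card_cap32]).  It
    follows that [link x] has at least [d2] elements.

    If [r >= 3], then [3 * a < 2 * (d2 + d3)], and these overlaps are large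
    enough to be chained: sets [link x], [link x'] that meet are equal
    ([link_trans]).  So the sets [link x] partition the vertices into blocks of
    size at most [a < n / r], hence more than [r] blocks, and of size at least
    [d2 > n / (r + 1)], hence fewer than [r + 1]: a contradiction
    ([block_contradiction]).

    If [r = 1], the assumption reads [d2 + d3 > n], so for any [H1]-edge [x y]
    some vertex is both an [H2]-neighbour of [x] and an [H3]-neighbour of [y],
    which gives a rainbow triangle ([edge_degree_sum_le]).

    The case [r = 2] is the delicate one, as chaining fails.  Here any two
    vertices have a common [H2]-neighbour ([nbhd2_meet]), hence any two sets
    [link x], [link y] share at least [d3] vertices.  On the other hand, inside
    the [H2]-neighbourhood of a fixed [v] there is room for only two disjoint
    [H3]-neighbourhoods of members of [link v], so up to an error of [a - d2]
    all sets [link q] with [q] in [link v] are contained in one of two of them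
    ([link_two_centres], [card_link_diff]).  Counting the linked pairs between
    [link v] and the complement of these two sets in two ways then gives
    [d3 ^ 2 <= a * (a - d2)], which is incompatible with
    [d3 > 2 * n / 3 - d2 > a / 3 + (a - d2)] ([two_parts_contradiction]). *)

(** * Finite sets and minimum degrees *)

Lemma leq_card_capl (T : finType) (A B C : {set T}) :
  A \subset C -> B \subset C -> (#|A| + #|B| <= #|C| + #|A :&: B|).
Proof.
by move=> sAC sBC; rewrite -cardsUI leq_add2r subset_leq_card // subUset sAC.
Qed.

Lemma card_cap_gt0 (T : finType) (A B C : {set T}) :
  A \subset C -> B \subset C -> (#|C| < #|A| + #|B|) -> A :&: B != set0.
Proof.
move=> sAC sBC ltC; rewrite -card_gt0.
by have := leq_card_capl sAC sBC; lia.
Qed.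

Lemma min_degree_le (V : finType) (H : sgraph V) x :
  (min_degree H <= degree H x).
Proof.
rewrite /min_degree; have : x \in index_enum V by apply: mem_index_enum.
elim: (index_enum V) => // y s IHs; rewrite inE big_cons geq_min.
by case/predU1P=> [<- | /IHs ->]; rewrite ?leqnn ?orbT.
Qed.

Lemma min_degree_le_card (V : finType) (H : sgraph V) : (min_degree H <= #|V|).
Proof.
rewrite /min_degree; elim/big_rec: _ => // x m _ le_m.
by rewrite geq_min le_m orbT.
Qed.

(** Both sides count the pairs in [A * B] related by [f]. *)
Lemma sum_card_cap_sym (V : finType) (f : V -> {set V}) (A B : {set V}) :
  (forall x y, y \in f x -> x \in f y) ->
  \sum_(x in A) #|f x :&: B| = \sum_(y in B) #|f y :&: A|.
Proof.
move=> f_sym.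
have capE x (C : {set V}) : #|f x :&: C| = \sum_(y in C) (y \in f x).
  rewrite -sum1_card big_mkcond [RHS]big_mkcond; apply: eq_bigr => y _.
  by rewrite in_setI; case: (y \in f x); case: (y \in C).
under eq_bigr do rewrite capE; under [RHS]eq_bigr do rewrite capE.
rewrite exchange_big; apply: eq_bigr => y _; apply: eq_bigr => x _ /=.
by congr (nat_of_bool _); apply/idP/idP; apply: f_sym.
Qed.

(** The second hypothesis makes any two sets [f x], [f x'] that meet equal, so
    the sets [f x] partition [V]; [m] is the number of blocks. *)
Lemma block_count (V : finType) (f : V -> {set V}) (lo hi : nat) :
    (forall x y, y \in f x -> x \in f y) ->
    (forall x y x' z, y \in f x -> y \in f x' -> z \in f x -> z \in f x') ->
    (0 < lo) -> (forall x, lo <= #|f x| <= hi) ->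
  exists m, (m * lo <= #|V| <= m * hi).
Proof.
move=> f_sym f_trans lo_gt0 f_card; pose B := [set f x | x in V].
have f_eq x y x' : y \in f x -> y \in f x' -> f x = f x'.
  by move=> yx yx'; apply/setP=> z; apply/idP/idP; apply: f_trans; eassumption.
have partB : partition B [set: V].
  apply/and3P; split.
  - apply/eqP/setP=> y; rewrite inE; apply/bigcupP.
    have /andP[fy_lo _] := f_card y.
    have /card_gt0P[x xy] := leq_trans lo_gt0 fy_lo.
    by exists (f x); [apply: imset_f | apply: f_sym].
  - apply/trivIsetP=> _ _ /imsetP[x _ ->] /imsetP[x' _ ->]; apply: contraNT.
    by case/pred0Pn=> y /andP[yx yx']; apply/eqP; apply: f_eq yx yx'.
  - apply/imsetP=> -[x _ fx0]; have /andP[] := f_card x.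
    by rewrite -fx0 cards0 leqNgt lo_gt0.
exists #|B|; rewrite -cardsT (card_partition partB) -!sum_nat_const.
by apply/andP; split; apply: leq_sum => _ /imsetP[x _ ->]; have /andP[] := f_card x.
Qed.

(** * Linked vertices *)

Definition nbhd (V : finType) (H : sgraph V) (x : V) : {set V} := [set y | H x y].

(** This contains [x] itself, so that its size is exactly [#|V| - degree H x]. *)
Definition far (V : finType) (H : sgraph V) (x : V) : {set V} := [set y | ~~ H x y].

Lemma mem_nbhdC (V : finType) (H : sgraph V) x y :
  (y \in nbhd H x) = (x \in nbhd H y).
Proof. by rewrite !inE adj_sym. Qed.

Lemma mem_farC (V : finType) (H : sgraph V) x y :
  (y \in far H x) = (x \in far H y).
Proof. by rewrite !inE adj_sym. Qed.

Section RainbowFree.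

Variables (V : finType) (H1 H2 H3 : sgraph V) (a d2 d3 : nat).
Hypothesis rainbow_free : forall x y z, H1 x y -> H2 x z -> H3 y z -> False.
Hypothesis far_le : forall x, (#|far H1 x| <= a).
Hypothesis nbhd2_ge : forall x, (d2 <= #|nbhd H2 x|).
Hypothesis nbhd3_ge : forall x, (d3 <= #|nbhd H3 x|).
Hypothesis d3_le_d2 : (d3 <= d2).
Hypothesis d3_gt0 : (0 < d3).
Hypothesis a_lt_sum : (a < d2 + d3).

Local Notation N2 := (nbhd H2).
Local Notation N3 := (nbhd H3).
Local Notation M := (far H1).

Definition link (x : V) : {set V} := [set y | N2 x :&: N3 y != set0].

Lemma linkI x y w : w \in N2 x -> w \in N3 y -> y \in link x.
Proof. by move=> wx wy; rewrite inE; apply/set0Pn; exists w; rewrite in_setI wx. Qed.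

Lemma linkE x y : y \in link x -> exists2 w, w \in N2 x & w \in N3 y.
Proof. by rewrite inE => /set0Pn[w /setIP[wx wy]]; exists w. Qed.

(** A vertex of [link x] that were [H1]-adjacent to [x] would span a rainbow
    triangle with [x] and the common neighbour. *)
Lemma link_sub_far x : link x \subset M x.
Proof.
apply/subsetP=> y /linkE[w]; rewrite !inE => xw yw.
by apply/negP=> xy; apply: rainbow_free xy xw yw.
Qed.

Lemma nbhd3_sub_link x w : w \in N2 x -> N3 w \subset link x.
Proof. by move=> wx; apply/subsetP=> y; rewrite mem_nbhdC; apply: linkI. Qed.

Lemma nbhd2_sub_far x w : w \in N3 x -> N2 w \subset M x.
Proof.
move=> wx; apply/subsetP=> y; rewrite mem_nbhdC => wy.
by rewrite mem_farC (subsetP (link_sub_far y)) // (linkI wy).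
Qed.

Lemma nbhd3_sub_far x w : w \in N2 x -> N3 w \subset M x.
Proof. by move/nbhd3_sub_link/subset_trans; apply; apply: link_sub_far. Qed.

(** Linking is defined by [N2 x] meeting [N3 y]; its consequence is a
    quantitative overlap of the two other neighbourhoods, which both lie in the
    non-neighbourhood of the vertex that links [x] to [y]. *)
Lemma card_cap32 x y :
  y \in link x -> (#|N3 x| + #|N2 y| <= a + #|N3 x :&: N2 y|).
Proof.
case/linkE=> w wx wy; apply: leq_trans (_ : _ <= #|M w| + _) _.
  apply: leq_card_capl; first by apply: nbhd3_sub_far; rewrite mem_nbhdC.
  by apply: nbhd2_sub_far; rewrite mem_nbhdC.
by rewrite leq_add2r.
Qed.

Lemma link_sym x y : y \in link x -> x \in link y.
Proof.
move/card_cap32=> le_cap; rewrite inE setIC -card_gt0.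
by have := nbhd2_ge y; have := nbhd3_ge x; lia.
Qed.

Lemma card_cap23 x y :
  y \in link x -> (#|N2 x| + #|N3 y| <= a + #|N2 x :&: N3 y|).
Proof. by move/link_sym/card_cap32; rewrite setIC addnC. Qed.

Lemma nbhd2_sub_link x w : w \in N3 x -> N2 w \subset link x.
Proof.
move=> wx; apply/subsetP=> y; rewrite mem_nbhdC => wy.
by apply/link_sym/(linkI wy).
Qed.

Lemma nbhd3_neq0 x : exists w, w \in N3 x.
Proof. by apply/card_gt0P; have := nbhd3_ge x; lia. Qed.

Lemma link_le x : (#|link x| <= a).
Proof. exact: leq_trans (subset_leq_card (link_sub_far x)) (far_le x). Qed.

Lemma link_ge x : (d2 <= #|link x|).
Proof.
have [w /nbhd2_sub_link/subset_leq_card] := nbhd3_neq0 x.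
exact: leq_trans (nbhd2_ge w).
Qed.

(** * Three or more parts: the linked sets form a partition *)

(** [N2 z] and [N2 y] each miss at most [a - d2] elements of [N3 x], so they
    overlap there; [N3 x'] misses at most [a - d3] elements of [N2 y], hence
    reaches that overlap.  The bound on [3 * a] says that the overlap, at least
    [d3 - 2 * (a - d2)], exceeds this last loss. *)
Lemma link_trans x y x' z : (3 * a < 2 * (d2 + d3)) ->
  y \in link x -> y \in link x' -> z \in link x -> z \in link x'.
Proof.
move=> lt_a yx yx' zx; apply/link_sym.
have le_z := card_cap23 (link_sym zx); have le_y := card_cap32 yx.
have le_y' := card_cap23 (link_sym yx').
have le_zy := leq_card_capl (subsetIr (N2 z) (N3 x)) (subsetIl (N3 x) (N2 y)).
have [u] : exists u, u \in (N2 z :&: N3 x :&: (N3 x :&: N2 y)) :&: (N2 y :&: N3 x').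
  apply/set0Pn; apply: (@card_cap_gt0 _ _ _ (N2 y)).
  - by rewrite setIA subsetIr.
  - exact: subsetIl.
  have := nbhd2_ge z; have := nbhd3_ge x; have := nbhd3_ge x'.
  have := nbhd2_ge y; lia.
rewrite !inE => /andP[/andP[/andP[zu _] _] /andP[_ ux']].
by apply/set0Pn; exists u; rewrite !inE zu.
Qed.

Lemma block_contradiction r : (0 < r) ->
  (3 * a < 2 * (d2 + d3)) -> (r * a < #|V|) -> (#|V| < r.+1 * d2) -> False.
Proof.
move=> r_gt0 lt_a lt_ra lt_rd2.
have [||||m /andP[m_lo m_hi]] := @block_count V link d2 a.
- exact: link_sym.
- by move=> x y x' z; apply: link_trans.
- by lia.
- by move=> x; rewrite link_ge link_le.
have : (r < m) by rewrite -(@ltn_pmul2r a); lia.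
have : (m < r.+1) by rewrite -(@ltn_pmul2r d2); lia.
by lia.
Qed.

(** * Two parts *)

Section TwoParts.

Hypothesis far_lt_half : (2 * a < #|V|).
Hypothesis sum_gt : (2 * #|V| < 3 * (d2 + d3)).

(** If [N2 x] and [N2 y] were disjoint, then so would be [N3 x] and [N3 y].  With
    a common [H1]-neighbour [z] of [x] and [y], every vertex lies in at most two
    of the six neighbourhoods of [x], [y], [z] in [H2] and [H3], although their
    sizes add up to more than [2 * #|V|]. *)
Lemma nbhd2_meet x y : exists w, w \in N2 x :&: N2 y.
Proof.
apply/set0Pn/negP=> /eqP N2xy0.
have N3xy0 : N3 x :&: N3 y = set0.
  apply/eqP/negPn/negP=> /set0Pn[w /setIP[wx wy]].
  have /negP[] : N2 x :&: N2 y != set0.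
    apply: (@card_cap_gt0 _ _ _ (M w)).
    - by apply: nbhd2_sub_far; rewrite mem_nbhdC.
    - by apply: nbhd2_sub_far; rewrite mem_nbhdC.
    by have := nbhd2_ge x; have := nbhd2_ge y; have := far_le w; lia.
  by rewrite N2xy0.
have [z] : exists z, z \notin M x :|: M y.
  have : (0 < #|~: (M x :|: M y)|).
    have := cardsC (M x :|: M y); have := cardsUI (M x) (M y).
    by have := far_le x; have := far_le y; lia.
  by case/card_gt0P=> z; rewrite inE; exists z.
rewrite !inE negb_or !negbK => /andP[xz yz].
have sum_hits (A : {set V}) : #|A| = (\sum_v (v \in A)).
  by rewrite -sum1_card big_mkcond.
suff: (#|N2 x| + #|N3 x| + (#|N2 y| + #|N3 y|) + (#|N2 z| + #|N3 z|)
        <= #|V| * 2).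
  have := nbhd2_ge x; have := nbhd2_ge y; have := nbhd2_ge z.
  by have := nbhd3_ge x; have := nbhd3_ge y; have := nbhd3_ge z; lia.
rewrite -[#|V| * 2]sum_nat_const !sum_hits -!big_split; apply: leq_sum => v _ /=.
move/setP/(_ v): N2xy0; move/setP/(_ v): N3xy0.
have free u w : H1 u w -> (v \in N2 u) && (v \in N3 w) = false.
  by move=> uw; apply/negP; rewrite !inE => /andP[uv wv]; apply: rainbow_free uw uv wv.
have := free x z xz; have := free y z yz.
have := free z x; have := free z y; rewrite ![H1 z _]adj_sym => /(_ yz) + /(_ xz).
rewrite !in_setI !inE.
by case: (H2 x v); case: (H2 y v); case: (H2 z v);
   case: (H3 x v); case: (H3 y v); case: (H3 z v).
Qed.

Lemma card_link_cap x y : (d3 <= #|link x :&: link y|).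
Proof.
have [t /setIP[tx ty]] := nbhd2_meet x y.
apply: leq_trans (nbhd3_ge t) (subset_leq_card _).
by rewrite subsetI !nbhd3_sub_link.
Qed.

(** A common [H3]-neighbour [s] puts the large set [N2 s] in both linked sets,
    whose size is at most [a]. *)
Lemma card_link_diff q q' :
  N3 q :&: N3 q' != set0 -> (#|link q :\: link q'| + d2 <= a).
Proof.
case/set0Pn=> s /setIP[sq sq'].
have le_s : (d2 <= #|link q :&: link q'|).
  apply: leq_trans (nbhd2_ge s) (subset_leq_card _).
  by rewrite subsetI !nbhd2_sub_link.
by have := cardsID (link q') (link q); have := link_le q; lia.
Qed.

(** Every [N3 q] with [q] linked to [v] has at least [d3 + #|N2 v| - a] elements
    in [N2 v].  Three disjoint such sets would exceed [N2 v], so a maximal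
    disjoint family of them has at most two members. *)
Lemma link_two_centres v : exists q1 q2, forall q, q \in link v ->
  (N3 q :&: N3 q1 != set0) || (N3 q :&: N3 q2 != set0).
Proof.
have [q1 q1v] : exists q1, q1 \in link v.
  by apply/card_gt0P; have := link_ge v; lia.
have [q2 /andP[q2v dis12]|meet1] :=
  pickP [pred q | (q \in link v) && (N3 q :&: N3 q1 == set0)]; last first.
  by exists q1, q1 => q qv; have := meet1 q; rewrite /= qv /= orbb => ->.
exists q1, q2 => q qv; apply/negPn/negP; rewrite negb_or !negbK => /andP[dis1 dis2].
have big p : p \in link v -> (d3 + #|N2 v| <= a + #|N2 v :&: N3 p|).
  by move/card_cap23; have := nbhd3_ge p; lia.
have /subset_leq_card : N2 v :&: N3 q1 :|: N2 v :&: N3 q2 :|: N2 v :&: N3 q \subset N2 v.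
  by rewrite !subUset !subsetIl.
have capI (A B : {set V}) : A :&: B == set0 -> #|N2 v :&: B :&: (N2 v :&: A)| = 0.
  move/eqP=> AB0; apply/eqP; rewrite cards_eq0 -subset0 -AB0.
  by apply/subsetP=> u; rewrite !inE => /andP[/andP[_ ->] /andP[_ ->]].
have := cardsUI (N2 v :&: N3 q1 :|: N2 v :&: N3 q2) (N2 v :&: N3 q).
have := cardsUI (N2 v :&: N3 q1) (N2 v :&: N3 q2).
have [+ _] := leq_card_setU (N2 v :&: N3 q1 :&: (N2 v :&: N3 q))
                            (N2 v :&: N3 q2 :&: (N2 v :&: N3 q)).
rewrite -setIUl (capI _ _ dis12) (capI _ _ dis1) (capI _ _ dis2).
have := big _ q1v; have := big _ q2v; have := big _ qv.
have := leq_trans (link_ge v) (link_le v); have := nbhd2_ge v.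
by lia.
Qed.

(** Each [x] outside [U], the union of the two central linked sets, is linked to
    at least [d3] elements of [link v], whereas each [q] in [link v] is linked to
    at most [a - d2] vertices outside [U].  The two central sets also share [d3]
    elements, so more than [d3] vertices are outside [U]. *)
Lemma two_parts_contradiction : False.
Proof.
have /card_gt0P[v _] : 0 < #|V| by lia.
have [q1 [q2 meet]] := link_two_centres v.
pose U := link q1 :|: link q2.
have U_card : (#|V| + d3 <= #|~: U| + 2 * a).
  have := cardsC U; have := cardsUI (link q1) (link q2).
  have := link_le q1; have := link_le q2; have := card_link_cap q1 q2.
  by rewrite /U; lia.
have low : (\sum_(x in ~: U) d3 <= \sum_(x in ~: U) #|link x :&: link v|).
  by apply: leq_sum => x _; apply: card_link_cap.
have upp : (\sum_(q in link v) #|link q :\: U| <= \sum_(q in link v) (a - d2)).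
  apply: leq_sum => q qv.
  have /orP[] := meet q qv => /card_link_diff le_a.
    apply: (@leq_trans #|link q :\: link q1|); last by lia.
    by rewrite subset_leq_card // setDS // subsetUl.
  apply: (@leq_trans #|link q :\: link q2|); last by lia.
  by rewrite subset_leq_card // setDS // subsetUr.
have swap : (\sum_(x in ~: U) #|link x :&: link v|
              = \sum_(q in link v) #|link q :\: U|).
  under [RHS]eq_bigr => q _ do rewrite setDE.
  by apply: sum_card_cap_sym => x y; apply: link_sym.
move: low upp; rewrite swap !sum_nat_const => low upp.
have := link_le v; have := leq_trans (link_ge v) (link_le v).
have low' : d3 * d3 <= #|~: U| * d3 by rewrite leq_mul2r; apply/orP; right; lia.
have upp' : #|link v| * (a - d2) <= a * (a - d2) by rewrite leq_mul2r link_le orbT.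
(* With [e = a - d2] one has [3 * d3 > a + 3 * e], while [d3 ^ 2 <= a * e]
   would need [(a + 3 * e) ^ 2 < 9 * a * e], impossible as the quadratic form
   [a ^ 2 - 3 * a * e + 9 * e ^ 2] is nonnegative. *)
have := leq_trans (leq_trans low' low) (leq_trans upp upp').
by nia.
Qed.

End TwoParts.

End RainbowFree.

(** * The degree bound *)

(** The case of one part: at an [H1]-edge [x y], degrees summing to more than
    [#|V|] make the [H2]-neighbourhood of [x] meet the [H3]-neighbourhood of
    [y]. *)
Lemma edge_degree_sum_le (V : finType) (H1 H2 H3 : sgraph V) (a d2 d3 : nat) :
    (forall x y z, H1 x y -> H2 x z -> H3 y z -> False) ->
    (forall x, #|far H1 x| <= a) ->
    (forall x, d2 <= #|nbhd H2 x|) -> (forall x, d3 <= #|nbhd H3 x|) ->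
  a < #|V| -> d2 + d3 <= #|V|.
Proof.
move=> rainbow_free far_le nbhd2_ge nbhd3_ge lt_aV; rewrite leqNgt; apply/negP=> sum_gt.
have /card_gt0P[x _] : 0 < #|V| by lia.
have /card_gt0P[y] : 0 < #|~: far H1 x|.
  by have := cardsC (far H1 x); have := far_le x; lia.
rewrite !inE negbK => xy.
have /set0Pn[z] : nbhd H2 x :&: nbhd H3 y != set0.
  apply: (@card_cap_gt0 _ _ _ setT); rewrite ?subsetT // cardsT.
  by have := nbhd2_ge x; have := nbhd3_ge y; lia.
by rewrite !inE => /andP[xz yz]; apply: rainbow_free xy xz yz.
Qed.

Lemma degree_sum_bound (V : finType) (H1 H2 H3 : sgraph V) (a d2 d3 r : nat) :
    (forall x y z, H1 x y -> H2 x z -> H3 y z -> False) ->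
    (forall x, #|far H1 x| <= a) ->
    (forall x, d2 <= #|nbhd H2 x|) -> (forall x, d3 <= #|nbhd H3 x|) ->
    d3 <= d2 -> 0 < d3 -> 0 < r -> r * a < #|V| ->
  (d2 + d3) * r.+1 <= 2 * #|V|.
Proof.
move=> free far_le ge2 ge3 le32 d3_gt0 r_gt0 lt_ra.
rewrite leqNgt; apply/negP=> sum_gt.
have a_lt_sum : a < d2 + d3.
  have : r.+1 * a < r.+1 * (d2 + d3) by nia.
  by rewrite ltn_pmul2l.
have [r1 | r2 | r3] := ltngtP r 2.
- have r_1 : r = 1 by lia.
  have := edge_degree_sum_le free far_le ge2 ge3.
  by rewrite r_1 in lt_ra sum_gt; lia.
- apply: (block_contradiction free far_le ge2 ge3 le32 d3_gt0 a_lt_sum r_gt0 _ lt_ra).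
    (* [r.+1 * 3 * a < 3 * r.+1 * n / r <= 4 * n] holds because [3 <= r]. *)
    have : r * (r.+1 * (3 * a)) < r * (r.+1 * (2 * (d2 + d3))) by nia.
    by rewrite !ltn_pmul2l.
  by nia.
- subst r; apply: (two_parts_contradiction free far_le ge2 ge3) => //; lia.
Qed.

Lemma mem_edges (V : finType) (H : sgraph V) x y : H x y -> [set x; y] \in edges H.
Proof. by move=> xy; apply/imset2P; exists x y; rewrite ?inE. Qed.

Lemma no_rainbow_free (V : finType) (G : template V) :
    ~ (exists e1 e2 e3 : {set V}, rainbow_triangle G e1 e2 e3) ->
  forall x y z, G1 G x y -> G2 G x z -> G3 G y z -> False.
Proof.
move=> no_rainbow x y z xy xz yz; apply: no_rainbow.
exists [set x; y], [set x; z], [set y; z]; split; try exact: mem_edges.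
have neq (H : sgraph V) u v : H u v -> u != v.
  by move=> uv; apply: contraTneq uv => ->; rewrite adj_irrefl.
exists x, y, z; split; [exact: neq xy | exact: neq yz | | ].
  by rewrite eq_sym; apply: neq xz.
by rewrite /triangle_edges (setUC [set z]) setUAC.
Qed.

Local Open Scope ring_scope.

Theorem theorem1p4 (V : finType) (n r : nat) (G : template V)
  (cardV : #|V| = n) (r_ge1 : (1 <= r)%N)
  (no_rainbow : ~ exists e1 e2 e3 : {set V}, rainbow_triangle G e1 e2 e3)
  (delta1 : (1 - 1 / r%:R) * n%:R < (min_degree (G1 G))%:R :> rat)
  (delta23 : (min_degree (G3 G) <= min_degree (G2 G))%N)
  (delta3 : (0 < min_degree (G3 G))%N) :
  (min_degree (G2 G))%:R + (min_degree (G3 G))%:R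
    <= 2 * n%:R / (r%:R + 1) :> rat
  /\ (min_degree (G3 G))%:R <= n%:R / (r%:R + 1) :> rat.
Proof.
subst n; have r_gt0 : 0 < r%:R :> rat by rewrite ltr0n.
have d1_gt : (r * #|V| < r * min_degree (G1 G) + #|V|)%N.
  rewrite -(ltr_nat rat) natrD !natrM -ltrBlDr.
  move: delta1; rewrite -(ltr_pM2l r_gt0); congr (_ < _).
  by field; rewrite gt_eqF.
have far_le x : (#|far (G1 G) x| <= #|V| - min_degree (G1 G))%N.
  have -> : far (G1 G) x = ~: nbhd (G1 G) x by apply/setP=> y; rewrite !inE.
  have : (min_degree (G1 G) <= #|nbhd (G1 G) x|)%N := min_degree_le (G1 G) x.
  by have := cardsC (nbhd (G1 G) x); lia.
have lt_ra : (r * (#|V| - min_degree (G1 G)) < #|V|)%N.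
  by have := min_degree_le_card (G1 G); nia.
have := degree_sum_bound (no_rainbow_free no_rainbow) far_le
  (min_degree_le (G2 G)) (min_degree_le (G3 G)) delta23 delta3 r_ge1 lt_ra.
rewrite -(ler_nat rat) !natrM natrD -addn1 natrD => sum_le.
have r1_gt0 : 0 < r%:R + 1 :> rat by rewrite ltr_wpDl // ltW.
rewrite !ler_pdivlMr //; split=> //.
move: sum_le delta23; rewrite -(ler_nat rat).
by nra.
Qed.
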